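(* Let $R$ be a commutative ring with $1\neq 0$, let $I$ be a weakly 1-absorbing primary ideal of $R$, and let $(a,b,c)$ be a 1-triple-zero of $I$. Then: (1) $abI=0$. (2) If $a,b\notin(I:c)$, then $bcI=acI=aI^2=bI^2=cI^2=0$. (3) If $a,b\notin(I:c)$, then $I^3=0$.
   Context: All rings are commutative with $1\neq 0$. For an ideal $I$ of $R$, $\sqrt{I}=\{a\in R : a^n\in I \text{ for some positive integer } n\}$, and for $c\in R$, $(I:c)=\{r\in R : rc\in I\}$. A proper ideal $I$ of $R$ is called weakly 1-absorbing primary if whenever $a,b,c\in R$ are nonunit elements and $0\neq abc\in I$, then $ab\in I$ or $c\in\sqrt{I}$. For a weakly 1-absorbing primary ideal $I$ and nonunit elements $a,b,c\in R$, the triple $(a,b,c)$ is called a 1-triple-zero of $I$ if $abc=0$, $ab\notin I$, and $c\notin\sqrt{I}$. *)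

(* Defs.v *)
From mathcomp Require Import all_boot all_order all_algebra.
From mathcomp Require Import all_classical.

Set Implicit Arguments.
Unset Strict Implicit.
Unset Printing Implicit Defensive.

Import GRing.Theory.
Local Open Scope ring_scope.
Local Open Scope classical_set_scope.

Section Ideals.
Variable R : comNzRingType.
Implicit Types (I J : set R) (a b c : R).

(* [GRing.unit] is not available here: a [comNzRingType] carries no
   inverse operation and no decision procedure for invertibility. *)
Definition nonunit a : Prop := ~ exists b, a * b = 1.

(* [idealr_closed] already includes properness, in the form [1 \notin I]. *)
Definition properIdeal I : Prop := idealr_closed (mem I).

Definition radical I : set R := [set a | exists2 n : nat, (0 < n)%N & I (a ^+ n)].

Definition colon I c : set R := [set r | I (r * c)].

Definition mulElt a J : set R := [set a * x | x in J].

Definition mulIdeal I J : set R :=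
  [set x | exists n : nat, exists u v : 'I_n -> R,
     (forall i, I (u i) /\ J (v i)) /\ x = \sum_(i < n) u i * v i].

Definition weakly_1_absorbing_primary I : Prop :=
  properIdeal I /\
  forall a b c, nonunit a -> nonunit b -> nonunit c ->
    a * b * c != 0 -> I (a * b * c) -> I (a * b) \/ radical I c.

Definition triple_zero1 I a b c : Prop :=
  [/\ nonunit a, nonunit b & nonunit c] /\
  [/\ a * b * c = 0, ~ I (a * b) & ~ radical I c].

End Ideals.

(* Main.v *)
Require Import Defs.
From mathcomp Require Import all_boot all_order all_algebra.
From mathcomp Require Import all_classical.
From mathcomp Require Import ring.

(** If [(a, b, c)] is a 1-triple-zero and [x], [y], [z] lie in [I], then
    [(a + x)(b + y)(c + z)] lies in [I], and moving from [a, b, c] to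
    [a + x, b + y, c + z] preserves non-membership of [ab], [ac], [bc] in [I]
    and of [c] in its radical.  The factor complementary to [ab] cannot become
    a unit, since [ab] is not in [I], and likewise for [ac] and [bc].  So the
    perturbed product vanishes: always if only [c] is moved, and for all [x],
    [y], [z] if [ac] and [bc] are not in [I].  Expanding it with more and more
    nonzero perturbations gives the vanishing statements one after the other. *)

Set Implicit Arguments.
Unset Strict Implicit.
Unset Printing Implicit Defensive.

Import GRing.Theory.
Local Open Scope ring_scope.
Local Open Scope classical_set_scope.

Section IdealFacts.
Context {R : comNzRingType}.
Implicit Types (I J : set R) (a b c d x y z : R).

Lemma properIdeal0 I : properIdeal I -> I 0.
Proof. by case; rewrite inE. Qed.

Lemma properIdeal_lin I d x y :
  properIdeal I -> I x -> I y -> I (d * x + y).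
Proof.
by case=> _ _ Ilin Ix Iy; have := Ilin d x y; rewrite !inE; apply.
Qed.

Lemma properIdealMl I d x : properIdeal I -> I x -> I (d * x).
Proof.
move=> pI Ix; rewrite -[d * x]addr0.
exact: properIdeal_lin (properIdeal0 pI).
Qed.

Lemma properIdealD I x y : properIdeal I -> I x -> I y -> I (x + y).
Proof. by move=> pI Ix Iy; rewrite -[x]mul1r; apply: properIdeal_lin. Qed.

Lemma properIdealB I x y : properIdeal I -> I x -> I y -> I (x - y).
Proof. by move=> pI Ix Iy; rewrite addrC -mulN1r; apply: properIdeal_lin. Qed.

Lemma notin_mul_perturb I a b x y : properIdeal I -> I x -> I y ->
  ~ I (a * b) -> ~ I ((a + x) * (b + y)).
Proof.
move=> pI Ix Iy nIab Iaxby; apply: nIab.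
have -> : a * b = (a + x) * (b + y) - (b * x + (a + x) * y) by ring.
apply: properIdealB => //.
by apply: properIdeal_lin => //; apply: properIdealMl.
Qed.

Lemma notin_radical_perturb I c z : properIdeal I -> I z ->
  ~ radical I c -> ~ radical I (c + z).
Proof.
move=> pI Iz nrc [n n_gt0 Icz]; apply: nrc; exists n => //.
rewrite -[c ^+ n](subKr ((c + z) ^+ n)); apply: properIdealB => //.
by rewrite subrXX addrAC subrr add0r mulrC; apply: properIdealMl.
Qed.

Lemma nonunit_of_mul I a d : properIdeal I -> I (a * d) -> ~ I d -> nonunit a.
Proof.
move=> pI Iad nId [e ae1]; apply: nId.
have -> : d = e * (a * d) by rewrite mulrA [e * a]mulrC ae1 mul1r.
exact: properIdealMl.
Qed.

Lemma mul_mulIdeal_eq0 I J a :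
  (forall x y, I x -> J y -> a * x * y = 0) ->
  forall w, mulIdeal I J w -> a * w = 0.
Proof.
move=> aIJ0 w [n [u [v [uv ->]]]]; rewrite mulr_sumr big1 // => i _.
by rewrite mulrA aIJ0 //; case: (uv i).
Qed.

Lemma mulIdeal_has0 I J : mulIdeal I J 0.
Proof.
exists 0%N, (fun=> 0), (fun=> 0).
by split; [case | rewrite big_ord0].
Qed.

Lemma mulIdeal_eq0 I J :
  (forall x y, I x -> J y -> x * y = 0) -> mulIdeal I J = [set 0].
Proof.
move=> IJ0; apply/seteqP; split=> w /=; last first.
  by move=> ->; apply: mulIdeal_has0.
move=> IJw; rewrite -[w]mul1r; apply: mul_mulIdeal_eq0 IJw => x y Ix Jy.
by rewrite mul1r IJ0.
Qed.

Lemma mulElt_eq0 a J :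
  J 0 -> (forall x, J x -> a * x = 0) -> mulElt a J = [set 0].
Proof.
move=> J0 aJ0; apply/seteqP; split=> w /=; first by case=> x /aJ0 ->.
by move=> ->; exists 0; rewrite ?mulr0.
Qed.

End IdealFacts.

Section TripleZero.
Context {R : comNzRingType}.
Variables (I : set R) (a b c : R).
Hypothesis hI : weakly_1_absorbing_primary I.
Hypothesis habc : triple_zero1 I a b c.

Let pI : properIdeal I := hI.1.

Lemma perturbed_product_mem x y z :
  I x -> I y -> I z -> I ((a + x) * (b + y) * (c + z)).
Proof.
case: habc => _ [abc0 _ _] Ix Iy Iz.
have -> : (a + x) * (b + y) * (c + z) =
    (b + y) * (c + z) * x + (a * (c + z) * y + a * b * z) + a * b * c by ring.
rewrite abc0 addr0; apply: properIdeal_lin => //.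
by apply: properIdeal_lin => //; apply: properIdealMl.
Qed.

Lemma perturbed_product_eq0 x y z : I x -> I y -> I z ->
  nonunit (a + x) -> nonunit (b + y) -> (a + x) * (b + y) * (c + z) = 0.
Proof.
case: habc => _ [_ nIab nrc] Ix Iy Iz nua nub.
have Iprod := perturbed_product_mem Ix Iy Iz.
have nIab' := notin_mul_perturb pI Ix Iy nIab.
have nrc' := notin_radical_perturb pI Iz nrc.
have nuc : nonunit (c + z).
  by apply: nonunit_of_mul pI _ nIab'; rewrite mulrC.
have [//|prod_neq0] := eqVneq ((a + x) * (b + y) * (c + z)) 0.
by have [] := hI.2 _ _ _ nua nub nuc prod_neq0 Iprod.
Qed.

Lemma triple_zero_ab z : I z -> a * b * z = 0.
Proof.
case: habc => -[nua nub _] [abc0 _ _] Iz.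
have I0 := properIdeal0 pI.
have := perturbed_product_eq0 I0 I0 Iz; rewrite !addr0 => /(_ nua nub).
by rewrite mulrDr abc0 add0r.
Qed.

Hypotheses (nIac : ~ I (a * c)) (nIbc : ~ I (b * c)).

Lemma perturbed_product_eq0_colon x y z : I x -> I y -> I z ->
  (a + x) * (b + y) * (c + z) = 0.
Proof.
move=> Ix Iy Iz; have Iprod := perturbed_product_mem Ix Iy Iz.
apply: perturbed_product_eq0 => //.
- apply: nonunit_of_mul pI _ (notin_mul_perturb pI Iy Iz nIbc).
  by rewrite mulrA.
- apply: nonunit_of_mul pI _ (notin_mul_perturb pI Ix Iz nIac).
  by rewrite mulrA [(b + y) * _]mulrC.
Qed.

Lemma triple_zero_bc x : I x -> b * c * x = 0.
Proof.
case: habc => _ [abc0 _ _] Ix; have I0 := properIdeal0 pI.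
have := perturbed_product_eq0_colon Ix I0 I0; rewrite !addr0.
by rewrite !mulrDl abc0 add0r -mulrA mulrC.
Qed.

Lemma triple_zero_ac y : I y -> a * c * y = 0.
Proof.
case: habc => _ [abc0 _ _] Iy; have I0 := properIdeal0 pI.
have := perturbed_product_eq0_colon I0 Iy I0; rewrite !addr0.
by rewrite mulrDr mulrDl abc0 add0r mulrAC.
Qed.

Lemma triple_zero_a y z : I y -> I z -> a * y * z = 0.
Proof.
case: habc => _ [abc0 _ _] Iy Iz; have I0 := properIdeal0 pI.
have -> : a * y * z = (a + 0) * (b + y) * (c + z)
    - a * b * c - a * b * z - a * c * y by ring.
rewrite perturbed_product_eq0_colon // abc0 triple_zero_ab // triple_zero_ac //.
by rewrite !subr0.
Qed.

Lemma triple_zero_b x z : I x -> I z -> b * x * z = 0.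
Proof.
case: habc => _ [abc0 _ _] Ix Iz; have I0 := properIdeal0 pI.
have -> : b * x * z = (a + x) * (b + 0) * (c + z)
    - a * b * c - a * b * z - b * c * x by ring.
rewrite perturbed_product_eq0_colon // abc0 triple_zero_ab // triple_zero_bc //.
by rewrite !subr0.
Qed.

Lemma triple_zero_c x y : I x -> I y -> c * x * y = 0.
Proof.
case: habc => _ [abc0 _ _] Ix Iy; have I0 := properIdeal0 pI.
have -> : c * x * y = (a + x) * (b + y) * (c + 0)
    - a * b * c - a * c * y - b * c * x by ring.
rewrite perturbed_product_eq0_colon // abc0 triple_zero_ac // triple_zero_bc //.
by rewrite !subr0.
Qed.

Lemma triple_zero_cube x y z : I x -> I y -> I z -> x * y * z = 0.
Proof.
case: habc => _ [abc0 _ _] Ix Iy Iz.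
have -> : x * y * z = (a + x) * (b + y) * (c + z) - a * b * c - a * b * z
    - a * c * y - b * c * x - a * y * z - b * x * z - c * x * y by ring.
rewrite perturbed_product_eq0_colon // abc0 triple_zero_ab // triple_zero_ac //.
rewrite triple_zero_bc // triple_zero_a // triple_zero_b // triple_zero_c //.
by rewrite !subr0.
Qed.

End TripleZero.

Theorem theorem10 (R : comNzRingType) (I : set R) (a b c : R)
  (hI : weakly_1_absorbing_primary I) (habc : triple_zero1 I a b c) :
  [/\ mulElt (a * b) I = [set 0],
      ~ colon I c a -> ~ colon I c b ->
        [/\ mulElt (b * c) I = [set 0],
            mulElt (a * c) I = [set 0],
            mulElt a (mulIdeal I I) = [set 0],
            mulElt b (mulIdeal I I) = [set 0] &
            mulElt c (mulIdeal I I) = [set 0]] &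
      ~ colon I c a -> ~ colon I c b ->
        mulIdeal (mulIdeal I I) I = [set 0]].
Proof.
have I0 := properIdeal0 hI.1.
split=> [|nIac nIbc|nIac nIbc].
- by apply: mulElt_eq0 => // x; apply: (triple_zero_ab hI habc).
- split; apply: mulElt_eq0 => //; try exact: mulIdeal_has0.
  + by move=> x; apply: (triple_zero_bc hI habc).
  + by move=> x; apply: (triple_zero_ac hI habc).
  + by apply: mul_mulIdeal_eq0 => x y; apply: (triple_zero_a hI habc).
  + by apply: mul_mulIdeal_eq0 => x y; apply: (triple_zero_b hI habc).
  + by apply: mul_mulIdeal_eq0 => x y; apply: (triple_zero_c hI habc).
- apply: mulIdeal_eq0 => w z IIw Iz; rewrite mulrC.
  apply: mul_mulIdeal_eq0 IIw => x y Ix Iy.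
  exact: (triple_zero_cube hI habc).
Qed.
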